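(* Let $q\in\widetilde{\mathbb C}$, $\mu\in\mathbb C$, and let $\mathcal H(\mu,q)$ be the symmetrical form such that $\sigma\mathcal H(\mu,q)=\mathbf L(\mu-\tfrac12,q)$. Then: 1) (When $\mathcal H(\mu,q)$ is regular) the recurrence coefficients $\gamma_{n+1}$ of its monic orthogonal polynomial sequence are given, for $n\ge 0$, by $$\gamma_{2n+1}=q^{n}\big([n]_q+\mu+\tfrac12\big),\qquad \gamma_{2n+2}=q^{n}[n+1]_q .$$ 2) $\mathcal H(\mu,q)$ is regular if and only if $\mu\neq-[n]_q-\frac12$ for all $n\ge 0$. 3) $\mathcal H(\mu,q)$ is positive definite if and only if $q>0$ and $\mu>-\frac12$. 4) If $\mu\neq\frac{1}{\sqrt q(\sqrt q+1)}-\frac12$ and $\mu\neq-[n]_q-\frac12$ for all $n\ge0$, then $\mathcal H(\mu,q)$ is an $H_{\sqrt q}$-semiclassical form of class one satisfying $$H_{\sqrt q}\big(x\,\mathcal H(\mu,q)\big)+(\sqrt q+1)\left(x^2-\mu-\tfrac12\right)\mathcal H(\mu,q)=0 .$$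
   Context: $\mathcal P$ is the vector space of polynomials in one variable with complex coefficients and $\mathcal P'$ its dual; elements of $\mathcal P'$ are called forms; $\langle u,f\rangle$ is the action of $u$ on $f$ and $(u)_n=\langle u,x^n\rangle$ are the moments. All regular forms are normalized by $(u)_0=1$. A form is symmetrical (symmetric) if $(u)_{2n+1}=0$ for all $n\ge0$. Let $\widetilde{\mathbb C}=\{z\in\mathbb C: z\neq0,\ z^n\neq1\ \forall n\ge1\}$; $\sqrt{\cdot}$ is the principal square root; $[n]_q=\frac{q^n-1}{q-1}$. For a polynomial $g$, $\langle gu,f\rangle=\langle u,gf\rangle$. For $r\in\widetilde{\mathbb C}$, $(H_rf)(x)=\frac{f(rx)-f(x)}{(r-1)x}$ and $\langle H_ru,f\rangle=-\langle u,H_rf\rangle$. The form $\sigma u$ is defined by $\langle\sigma u,f\rangle=\langle u,f(x^2)\rangle$. A form $u$ is regular if there is a sequence of monic polynomials $\{B_n\}_{n\ge0}$, $\deg B_n=n$, with $\langle u,B_mB_n\rangle=r_n\delta_{n,m}$, $r_n\ne0$; then $B_0=1$, $B_1=x-\beta_0$, $B_{n+2}=(x-\beta_{n+1})B_{n+1}-\gamma_{n+1}B_n$ with $\gamma_{n+1}\neq0$, $n\ge0$ (for symmetrical $u$ all $\beta_n=0$). A symmetrical regular form is positive definite if all its $\gamma_{n+1}$ are positive reals. A form $u$ is $H_r$-semiclassical if it is regular and $H_r(\Phi u)+\Psi u=0$ for some polynomials $\Phi$ (monic, degree $t\ge0$) and $\Psi$ (degree $p\ge1$). It is of class $s=\max(p-1,t-2)$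 if the pair $(\Phi,\Psi)$ satisfies $$\prod_{c\in\mathcal Z_\Phi}\Big\{\big|r\Psi(rc)+(H_r\Phi)(c)\big|+\big|\langle u,\ r(\theta_{cr}\Psi)+\theta_{cr}(\theta_c\Phi)\rangle\big|\Big\}>0,$$ where $\mathcal Z_\Phi$ is the set of zeros of $\Phi$ and $(\theta_cf)(x)=\frac{f(x)-f(c)}{x-c}$. $\mathbf L(\alpha,q)$ (the $q$-analogue of the Laguerre form) is the form with $(\mathbf L(\alpha,q))_0=1$ satisfying $H_q(x\mathbf L(\alpha,q))+(x-1-\alpha)\mathbf L(\alpha,q)=0$. *)

(* Defs.v *)
(* Complex numbers are R[i] for an arbitrary model R : realType of the reals. *)
From HB Require Import structures.
From mathcomp Require Import all_boot all_order all_algebra.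
From mathcomp Require Import boolp classical_sets fsbigop reals ring.
From mathcomp Require Export complex.

Set Implicit Arguments.
Unset Strict Implicit.
Unset Printing Implicit Defensive.

Import Order.TTheory GRing.Theory Num.Theory.
Local Open Scope ring_scope.

(* The algebraic dual of the space of complex polynomials. *)
Notation cform R := {scalar {poly R[i]}}.

Section Forms.
Variable R : realType.
Local Notation C := R[i].
Implicit Types (u v : cform R) (f g Phi Psi : {poly C}) (r q c alpha mu : C).

Definition Ctilde (z : C) : Prop :=
  z != 0 /\ forall n : nat, (0 < n)%N -> z ^+ n != 1.

Definition qint q (n : nat) : C := (q ^+ n - 1) / (q - 1).

Definition moment u (n : nat) : C := u 'X^n.

(* x |-> (f(rx) - f(x)) / ((r-1)x); the division is exact, see [Hop_exact]. *)
Definition Hop r f : {poly C} := (f \Po (r *: 'X) - f) %/ ((r - 1) *: 'X).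

Lemma Hop_exact r f : r != 1 -> Hop r f * ((r - 1) *: 'X) = f \Po (r *: 'X) - f.
Proof.
move=> r1; rewrite /Hop divpK // dvdpZl ?subr_eq0 //.
rewrite -[X in X %| _]subr0 -polyC0 dvdp_XsubCl /root hornerD hornerN.
by rewrite horner_comp hornerZ hornerX mulr0 subrr.
Qed.

Lemma Hop_is_linear r : linear (Hop r).
Proof.
move=> a f g; rewrite /Hop linearP /= opprD addrACA -scalerBr.
by rewrite divpD divpZl.
Qed.
HB.instance Definition _ r :=
  GRing.isLinear.Build C {poly C} {poly C} *:%R (Hop r) (@Hop_is_linear r).

(* x |-> (f(x) - f(c)) / (x - c); the division is exact, see [theta_exact]. *)
Definition theta c f : {poly C} := (f - f.[c]%:P) %/ ('X - c%:P).

Lemma theta_exact c f : theta c f * ('X - c%:P) = f - f.[c]%:P.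
Proof. by rewrite /theta divpK // dvdp_XsubCl /root !hornerE subrr. Qed.

Definition mulf g u (f : {poly C}) : C := u (g * f).

Lemma mulf_is_scalar g u : scalar (mulf g u).
Proof. by move=> a f h; rewrite /mulf mulrDr -scalerAr linearP. Qed.
HB.instance Definition _ g u :=
  GRing.isLinear.Build C {poly C} C *%R (mulf g u) (@mulf_is_scalar g u).

Definition Hf r u (f : {poly C}) : C := - u (Hop r f).

Lemma Hf_is_scalar r u : scalar (Hf r u).
Proof. by move=> a f h; rewrite /Hf [Hop r _]linearP /= linearP /= opprD mulrN. Qed.
HB.instance Definition _ r u :=
  GRing.isLinear.Build C {poly C} C *%R (Hf r u) (@Hf_is_scalar r u).

Definition sigmaf u (f : {poly C}) : C := u (f \Po 'X^2).

Lemma sigmaf_is_scalar u : scalar (sigmaf u).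
Proof. by move=> a f h; rewrite /sigmaf !linearP. Qed.
HB.instance Definition _ u :=
  GRing.isLinear.Build C {poly C} C *%R (sigmaf u) (@sigmaf_is_scalar u).

Lemma form_eq u v : (forall n, moment u n = moment v n) -> u =1 v.
Proof.
move=> uv f; rewrite -[f]coefK poly_def !linear_sum /=.
by apply: eq_bigr => i _; rewrite !linearZ /=; congr (_ * _); apply: uv.
Qed.

Lemma form_of_moments (m : nat -> C) :
  {u : cform R | forall n, moment u n = m n}.
Proof.
pose F (f : {poly C}) := \sum_(i < size f) f`_i * m i.
have FE N f : (size f <= N)%N -> F f = \sum_(i < N) f`_i * m i.
  move=> fN; rewrite /F (big_ord_widen _ (fun i => f`_i * m i) fN) big_mkcond /=.
  apply: eq_bigr => i _; case: ltnP => // h.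
  by rewrite nth_default ?mul0r.
have Flin : scalar F.
  move=> a f g; pose N := maxn (size (a *: f + g)) (maxn (size f) (size g)).
  rewrite !(@FE N) ?leq_max ?leqnn ?orbT //.
  rewrite mulr_sumr -big_split /=; apply: eq_bigr => i _.
  by rewrite coefD coefZ mulrDl mulrA.
pose mix := GRing.isLinear.Build C {poly C} C *%R F Flin.
pose Fl : cform R := HB.pack F mix.
exists Fl => n; rewrite /moment /= /F size_polyXn big_ord_recr /=.
rewrite big1 ?add0r ?coefXn ?eqxx ?mul1r // => i _.
by rewrite coefXn ltn_eqF ?mul0r.
Qed.

Definition symmetrical u : Prop := forall n : nat, moment u n.*2.+1 = 0.

Definition is_MOPS u (B : nat -> {poly C}) : Prop :=
  (forall n, B n \is monic /\ size (B n) = n.+1) /\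
  exists2 k : nat -> C, (forall n, k n != 0) &
    forall m n, u (B m * B n) = if n == m then k n else 0.

Definition regular u : Prop := exists B, is_MOPS u B.

(* The value [gamma 0] plays no role. *)
Definition three_term (B : nat -> {poly C}) (beta gamma : nat -> C) : Prop :=
  [/\ B 0%N = 1,
      B 1%N = 'X - (beta 0%N)%:P &
      forall n, B n.+2 = ('X - (beta n.+1)%:P) * B n.+1 - gamma n.+1 *: B n].

Definition recurrence_coefs u (beta gamma : nat -> C) : Prop :=
  exists2 B, is_MOPS u B & three_term B beta gamma.

(* In R[i], [0 < z] means that z is real and positive. *)
Definition positive_definite u : Prop :=
  [/\ symmetrical u, regular u &
      exists beta gamma, recurrence_coefs u beta gamma /\
        forall n : nat, 0 < gamma n.+1].

(* H_r(Phi u) + Psi u = 0, an equality of forms. *)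
Definition Pearson r u Phi Psi : Prop :=
  forall f, Hf r (mulf Phi u) f + mulf Psi u f = 0.

Definition semiclassical_pair r u Phi Psi : Prop :=
  [/\ regular u, Phi \is monic, (1 < size Psi)%N & Pearson r u Phi Psi].

Definition class_condition r u Phi Psi : Prop :=
  0 < \big[*%R/1]_(c \in [set c : C | root Phi c]%classic)
        (`| r * Psi.[r * c] + (Hop r Phi).[c] | +
         `| u (r *: theta (c * r) Psi + theta (c * r) (theta c Phi)) |).

(* s = max(deg Psi - 1, deg Phi - 2); the truncated subtractions are harmless
   since deg Psi >= 1. *)
Definition semiclassical_of_class r u (s : nat) : Prop :=
  exists Phi Psi, [/\ semiclassical_pair r u Phi Psi,
    class_condition r u Phi Psi &
    s = maxn ((size Psi).-1 - 1) ((size Phi).-1 - 2)].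

Definition is_qLaguerre alpha q u : Prop :=
  moment u 0%N = 1 /\ Pearson q u 'X ('X - 1 - alpha%:P).

Definition is_Hform mu q u : Prop :=
  symmetrical u /\ is_qLaguerre (mu - 2^-1) q (sigmaf u).

Lemma qLaguerreP alpha q u : q != 1 -> is_qLaguerre alpha q u <->
  moment u 0%N = 1 /\
  forall n, moment u n.+1 = (qint q n + 1 + alpha) * moment u n.
Proof.
move=> q1.
have HX n : 'X * Hop q 'X^n = qint q n *: 'X^n.
  have q10 : q - 1 != 0 by rewrite subr_eq0.
  apply: (scalerI q10); rewrite scalerA /qint mulrCA divff // mulr1.
  rewrite mulrC scalerAr Hop_exact //.
  by rewrite comp_Xn_poly exprZn scalerBl scale1r.
have E n : Hf q (mulf 'X u) 'X^n + mulf ('X - 1 - alpha%:P) u 'X^n =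
    moment u n.+1 - (qint q n + 1 + alpha) * moment u n.
  have uZ a f : u (a *: f) = a * u f by exact: linearZ.
  rewrite /Hf /= /mulf HX !mulrBl mul1r mul_polyC -exprS.
  by rewrite !linearB /= !uZ /moment; ring.
split=> -[u0 h]; split=> //.
  by move=> n; apply/eqP; rewrite -subr_eq0 -E h.
move=> f; rewrite -[f]coefK poly_def !linear_sum -big_split /= big1 // => i _.
by rewrite !linearZ /= -mulrDr E h subrr mulr0.
Qed.

Lemma moment_sigmaf u n : moment (sigmaf u) n = moment u n.*2.
Proof. by rewrite /moment /= /sigmaf comp_Xn_poly -exprM mul2n. Qed.

(* [is_Hform mu q] characterizes exactly one form. *)
Lemma Hform_exists mu q : q != 1 -> {u : cform R | is_Hform mu q u}.
Proof.
move=> q1; pose a := fix a n := if n is n'.+1 then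
  (qint q n' + 1 + (mu - 2^-1)) * a n' else 1.
have [u uE] := form_of_moments (fun n => if odd n then 0 else a n./2).
exists u; split=> [n|]; first by rewrite uE /= odd_double.
apply/qLaguerreP => //; split=> [|n]; first by rewrite moment_sigmaf uE.
by rewrite !moment_sigmaf !uE !odd_double !doubleK.
Qed.

Lemma Hform_unique mu q u v : q != 1 ->
  is_Hform mu q u -> is_Hform mu q v -> u =1 v.
Proof.
move=> q1 [su /(qLaguerreP _ _ q1)[u0 uS]] [sv /(qLaguerreP _ _ q1)[v0 vS]].
apply: form_eq => n; rewrite -[n]odd_double_half; case: (odd n).
  by rewrite su sv.
rewrite add0n -!moment_sigmaf; elim: n./2 => [|k IH]; first by rewrite u0 v0.
by rewrite uS vS IH.
Qed.

End Forms.

(* Main.v *)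
Require Import Defs.
From mathcomp Require Import all_boot all_order all_algebra.
From mathcomp Require Import boolp classical_sets fsbigop.
From mathcomp Require Import reals.
From mathcomp Require Import ring.
Import Order.TTheory GRing.Theory Num.Theory.
Local Open Scope ring_scope.

(** Write [a = mu + 1/2] and [[n] = qint q n]. The q-Laguerre equation for the
    form [sigmaf H] says exactly that the even moments [m_n] of [H] satisfy
    [m_(n+1) = ([n] + a) m_n]; the odd ones vanish. Hence everything is
    explicit.

    Let [B] be the polynomials produced by the three-term recurrence with the
    announced coefficients [gamma]. The key point ([Hform_pairing]) is that all
    the pairings of [B n] with monomials have closed forms,
      [H (B_(2n) x^(2k)) = Q k n m_k],
      [H (B_(2n+1) x^(2k+1)) = q^n (Q k n) m_(k+1)],
    where [Q k n], the product over [i < n] of [q^i ([k] - [i])], is a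
    q-analogue of the falling factorial; pairings of opposite parity vanish.
    The recurrence for [B] proves this by induction, for every [mu]. As
    [Q k n = 0] for [k < n], the sequence [B] is always orthogonal to lower
    degrees; as [Q n n != 0] when [q] is neither 0 nor a root of unity,
    [H (B n x^n) != 0] for all [n] if and only if no even moment vanishes,
    i.e. no [[n] + a] vanishes.

    Any orthogonal sequence of a regular form is determined by orthogonality to
    lower degrees ([MOPS_unique]), so it must be [B]. This turns the previous
    equivalence into the regularity criterion, and it identifies the recurrence
    coefficients, from which positivity is read off: [gamma_1 = a > 0] and
    [gamma_3 = q (1 + a) > 0] force [q > 0], and conversely.

    Finally, if [r^2 = q], then [qint r (2k) = (r + 1) [k]], and the moment
    recurrence becomes the Pearson equation for the operator [Hop r] with
    [Phi = x]. The only zero of [Phi] is 0, where the first term of the class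
    condition is [1 - r (r + 1) a] in modulus; it is nonzero for the allowed
    [mu]. *)

(** * Monic orthogonal sequences *)
Section Orthogonality.
Set Implicit Arguments.
Unset Strict Implicit.
Variables (R : realType) (u : cform R).
Local Notation C := R[i].
Implicit Types (B : nat -> {poly C}) (D f : {poly C}).

Lemma formB f g : u (f - g) = u f - u g.
Proof. exact: linearB. Qed.

Lemma formZ (c : C) f : u (c *: f) = c * u f.
Proof. exact: linearZ. Qed.

Lemma orth_coef D n f : (forall k, (k < n)%N -> u (D * 'X^k) = 0) ->
  (size f <= n.+1)%N -> u (D * f) = f`_n * u (D * 'X^n).
Proof.
move=> Dn fn; have fE : f = \sum_(i < n.+1) f`_i *: 'X^i.
  rewrite -poly_def; apply/polyP => i; rewrite coef_poly; case: ltnP => // ni.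
  by rewrite nth_default // (leq_trans fn).
rewrite [in LHS]fE mulr_sumr linear_sum big_ord_recr /= big1 ?add0r.
  by rewrite -scalerAr formZ.
by move=> i _; rewrite -scalerAr formZ Dn ?mulr0.
Qed.

Lemma MOPS_of_orth B :
  (forall n, B n \is monic /\ size (B n) = n.+1) ->
  (forall n k, (k < n)%N -> u (B n * 'X^k) = 0) ->
  (forall n, u (B n * 'X^n) != 0) -> is_MOPS u B.
Proof.
move=> Bmon Borth Bnz; split=> //; exists (fun n => u (B n * 'X^n)) => // m n.
have lead i : (B i)`_i = 1.
  by have [/monicP + Bi] := Bmon i; rewrite lead_coefE Bi.
have low i j : (i < j)%N -> u (B j * B i) = 0.
  move=> ij; have [_ Bi] := Bmon i.
  rewrite (orth_coef (fun k => @Borth j k)) ?Bi ?ltnS ?(ltnW ij) //.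
  by rewrite nth_default ?Bi ?mul0r.
case: (ltngtP n m) => [nm|mn|nm]; [exact: low | by rewrite mulrC low |].
rewrite -{}nm.
have [_ Bi] := Bmon n.
by rewrite (orth_coef (fun k => @Borth n k)) ?Bi ?lead ?mul1r.
Qed.

(** Subtracting from [f] its top coefficient times [B j] lowers the degree
    without changing the pairing with [B n], so one descends to [f = 0]. *)
Lemma MOPS_orth B n f :
  is_MOPS u B -> (size f <= n)%N -> u (B n * f) = 0.
Proof.
move=> [Bmon [k _ Bk]].
suff: forall j (g : {poly C}), (j <= n)%N -> (size g <= j)%N -> u (B n * g) = 0.
  by move=> /(_ n f (leqnn n)).
elim=> [|j IH] g jn gj.
  by move: gj; rewrite leqn0 size_poly_eq0 => /eqP ->; rewrite mulr0 linear0.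
have [/monicP Bj1 Bj] := Bmon j; rewrite lead_coefE Bj /= in Bj1.
have gBj : (size (g - g`_j *: B j)%R <= j)%N.
  apply/leq_sizeP => i; rewrite leq_eqVlt coefB coefZ => /predU1P[<-|ji].
    by rewrite Bj1 mulr1 subrr.
  have [-> ->] : g`_i = 0 /\ (B j)`_i = 0.
    by rewrite !nth_default ?Bj // (leq_trans gj).
  by rewrite mulr0 subrr.
rewrite -[g](subrK (g`_j *: B j)) mulrDr linearD /= IH ?(ltnW jn) // add0r.
by rewrite -scalerAr formZ Bk ltn_eqF ?mulr0.
Qed.

Lemma MOPS_pairing B k : is_MOPS u B -> u (B k * B k) = u (B k * 'X^k).
Proof.
move=> HB; have [/(_ k)[/monicP + Bs] _] := HB; rewrite lead_coefE Bs /= => B1.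
rewrite (@orth_coef _ k) ?Bs ?B1 ?mul1r // => i ik.
by apply: MOPS_orth => //; rewrite size_polyXn.
Qed.

(** The difference [f = D - B n] has degree [j < n], and both terms are
    orthogonal to [B j]; but the pairing of [f] with [B j] is the leading
    coefficient of [f] times the nonzero norm of [B j], so [f = 0]. *)
Lemma MOPS_unique B D n : is_MOPS u B -> D \is monic -> size D = n.+1 ->
  (forall k, (k < n)%N -> u (D * 'X^k) = 0) -> D = B n.
Proof.
move=> HB D1 Dn Dorth; have [Bmon [k knz Bk]] := HB.
apply/eqP; rewrite -subr_eq0; set f := D - B n; apply: contraT => fnz.
have [/monicP Bn1 Bn] := Bmon n; rewrite lead_coefE Bn /= in Bn1.
move/monicP: D1; rewrite lead_coefE Dn /= => D1.
have fn : (size f <= n)%N.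
  apply/leq_sizeP => i; rewrite leq_eqVlt coefB => /predU1P[<-|ni].
    by rewrite D1 Bn1 subrr.
  by rewrite !nth_default ?Bn ?Dn ?subr0.
have := fnz; rewrite -size_poly_gt0; case Ef : (size f) => [//|j] _.
have jn : (j < n)%N by rewrite -Ef.
have [_ Bj] := Bmon j.
have : u (B j * f) = 0.
  rewrite mulrC mulrBl formB Bk ltn_eqF // subr0.
  by rewrite (@orth_coef _ n) ?Bj ?ltnS ?(ltnW jn) // nth_default ?Bj ?mul0r.
rewrite (@orth_coef _ j) ?Ef // => [|i ij]; last first.
  by apply: MOPS_orth => //; rewrite size_polyXn.
rewrite -MOPS_pairing // Bk eqxx => /eqP; rewrite mulf_eq0 (negbTE (knz j)) orbF.
by move: fnz; rewrite -lead_coef_eq0 lead_coefE Ef /= => /negbTE ->.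
Qed.

(** The sequence attached to vanishing [beta]. The index of [g] is shifted:
    [g n] is the coefficient usually written [gamma_(n+1)]. *)
Fixpoint sym_seq (g : nat -> C) (n : nat) : {poly C} :=
  if n is n1.+1 then
    if n1 is n2.+1 then 'X * sym_seq g n1 - g n2 *: sym_seq g n2 else 'X
  else 1.

Lemma sym_seqSS g n :
  sym_seq g n.+2 = 'X * sym_seq g n.+1 - g n *: sym_seq g n.
Proof. by []. Qed.

Lemma sym_seq_monic g n :
  sym_seq g n \is monic /\ size (sym_seq g n) = n.+1.
Proof.
suff: (sym_seq g n \is monic /\ size (sym_seq g n) = n.+1) /\
  (sym_seq g n.+1 \is monic /\ size (sym_seq g n.+1) = n.+2) by case.
elim: n => [|n [[m0 s0] [m1 s1]]].
  by rewrite /= monic1 size_poly1 monicX size_polyX.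
split=> //; rewrite sym_seqSS.
have sX : size ('X * sym_seq g n.+1) = n.+3.
  by rewrite mulrC size_mulX ?s1 // monic_neq0.
have lt : (size (- (g n *: sym_seq g n)) < size ('X * sym_seq g n.+1)%R)%N.
  by rewrite size_polyN sX ltnS (leq_trans (size_scale_leq _ _)) ?s0 // leqW.
split; last by rewrite size_polyDl.
by rewrite monicE lead_coefDl // -monicE rpredM ?monicX.
Qed.

Lemma sym_seq_three_term (g : nat -> C) :
  three_term (sym_seq g) (fun=> 0) (fun n => g n.-1).
Proof. by split=> //= [|n]; rewrite polyC0 subr0. Qed.

(** Equating the two recurrences for [B n.+2] gives a vanishing combination of
    [B n.+1] and [B n], which have distinct degrees. *)
Lemma sym_seq_coefs (g beta gamma : nat -> C) n :
  three_term (sym_seq g) beta gamma -> gamma n.+1 = g n.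
Proof.
case=> _ _ /(_ n); rewrite sym_seqSS => E.
have [/monicP m0 s0] := sym_seq_monic g n.
have [/monicP m1 s1] := sym_seq_monic g n.+1.
rewrite lead_coefE s0 /= in m0; rewrite lead_coefE s1 in m1.
have F : beta n.+1 *: sym_seq g n.+1 + (gamma n.+1 - g n) *: sym_seq g n = 0.
  move/eqP: E; rewrite -subr_eq0 -!mul_polyC polyCB => /eqP <-; ring.
have b0 : beta n.+1 = 0.
  move/(congr1 (fun p : {poly C} => p`_n.+1)): F.
  by rewrite coefD !coefZ m1 coef0 mulr1 nth_default ?s0 // mulr0 addr0.
move/(congr1 (fun p : {poly C} => p`_n)): F.
rewrite b0 scale0r add0r coefZ m0 coef0 mulr1 => /eqP.
by rewrite subr_eq0 => /eqP.
Qed.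

Lemma sym_seq_pairing g n k : u (sym_seq g n.+2 * 'X^k) =
  u (sym_seq g n.+1 * 'X^(k.+1)) - g n * u (sym_seq g n * 'X^k).
Proof.
rewrite sym_seqSS mulrBl -scalerAl formB formZ; congr (u _ - _).
by rewrite exprS mulrA [_ * 'X]mulrC.
Qed.

End Orthogonality.

(** * q-integers and q-falling factorials *)
Section QInteger.
Set Implicit Arguments.
Unset Strict Implicit.
Variables (R : realType) (q : R[i]).
Local Notation C := R[i].
Local Notation qn := (qint q).

Lemma qint0 : qn 0 = 0.
Proof. by rewrite /qint expr0 subrr mul0r. Qed.

Lemma qintE n : q != 1 -> qn n = \sum_(i < n) q ^+ i.
Proof. by rewrite -subr_eq0 => q1; rewrite /qint subrX1 mulrC mulKf. Qed.

Lemma qintSB n m : q != 1 -> qn n.+1 - qn m.+1 = q * (qn n - qn m).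
Proof.
move=> q1; rewrite !qintE // !big_ord_recl opprD addrACA subrr add0r mulrBr.
by congr (_ - _); rewrite mulr_sumr; apply: eq_bigr => i _; rewrite -exprS.
Qed.

Lemma qint_subr_neq0 n m : Ctilde q -> (m < n)%N -> qn n - qn m != 0.
Proof.
move=> [q0 q1] mn; have q1' : q - 1 != 0 by rewrite subr_eq0 (q1 1%N).
rewrite /qint -mulrBl mulf_neq0 ?invr_eq0 // subr_eq0 (inj_eq (addIr _)).
by rewrite -(subnKC (ltnW mn)) exprD -subr_eq0 -[X in _ - X]mulr1 -mulrBr
   mulf_neq0 ?expf_neq0 // subr_eq0 q1 ?subn_gt0.
Qed.

Lemma qint_gt0 n : 0 < q -> q != 1 -> 0 < qn n.+1.
Proof.
move=> q0 q1; rewrite qintE // big_ord_recl ltr_pwDl ?expr0 ?ltr01 //.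
by apply: sumr_ge0 => i _; rewrite exprn_ge0 // ltW.
Qed.

(** This is where the change of base from [q] to its square root comes from:
    the factor [q + 1] reappears in the polynomial [Psi] of the Pearson
    equation. *)
Lemma qint_sqr n : q ^+ 2 != 1 -> qint q n.*2 = (q + 1) * qint (q ^+ 2) n.
Proof.
move=> q21; have q1 : q != 1 by apply: contraNneq q21 => ->; rewrite expr1n.
by rewrite /qint -muln2 mulnC exprM; field; rewrite !subr_eq0 q21.
Qed.

Lemma mulX_Hop_Xn n : q != 1 -> 'X * Hop q 'X^n = qint q n *: 'X^n.
Proof.
move=> q1; have q10 : q - 1 != 0 by rewrite subr_eq0.
apply: (scalerI q10); rewrite scalerA /qint mulrCA divff // mulr1.
rewrite mulrC scalerAr Hop_exact //.
by rewrite comp_Xn_poly exprZn scalerBl scale1r.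
Qed.

(** For [n <= k] each factor equals [q^(2i) [k - i]], so this is
    [k][k-1]...[k-n+1] up to a power of [q]. The weights [q^i] make the closed forms of [Hform_pairing]
    hold for monic polynomials. *)
Definition qfall (k n : nat) : C := \prod_(i < n) (q ^+ i * (qn k - qn i)).

Lemma qfallSr k n : qfall k n.+1 = qfall k n * (q ^+ n * (qn k - qn n)).
Proof. by rewrite /qfall big_ord_recr. Qed.

Lemma qfallSS k n : q != 1 ->
  qfall k.+1 n.+1 = qn k.+1 * (q ^+ n * q ^+ n) * qfall k n.
Proof.
move=> q1; rewrite /qfall big_ord_recl expr0 mul1r qint0 subr0 -mulrA.
congr (_ * _); rewrite -exprMn_comm; last exact: mulrC.
rewrite -[X in _ = _ ^+ X * _](card_ord n) -prodr_const -big_split /=.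
by apply: eq_bigr => i _; rewrite qintSB // exprS; ring.
Qed.

Lemma qfall_small k n : (k < n)%N -> qfall k n = 0.
Proof.
by move=> kn; rewrite /qfall (bigD1 (Ordinal kn)) //= subrr mulr0 mul0r.
Qed.

Lemma qfall_neq0 n : Ctilde q -> qfall n n != 0.
Proof.
move=> hq; apply/prodf_neq0 => i _; rewrite mulf_neq0 ?qint_subr_neq0 //.
by rewrite expf_neq0 //; case: hq.
Qed.

End QInteger.

(** * The form H(mu, q) *)
Section HForm.
Set Implicit Arguments.
Unset Strict Implicit.
Variables (R : realType) (q mu : R[i]) (H : cform R).
Hypotheses (hq : Ctilde q) (hH : is_Hform mu q H).
Local Notation C := R[i].
Local Notation qn := (qint q).

Local Notation a := (mu + 2^-1).
Local Notation m n := (moment H (n.*2)).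

Lemma Ctilde_neq1 : q != 1.
Proof. by have [_ /(_ 1%N isT)] := hq. Qed.
Let q1 := Ctilde_neq1.

Lemma Hform_even_moment0 : m 0 = 1.
Proof. by have [_ [+ _]] := hH; rewrite moment_sigmaf. Qed.

Lemma Hform_even_momentS n : m n.+1 = (qn n + a) * m n.
Proof.
have [_ /(qLaguerreP _ _ q1)[_ /(_ n)]] := hH; rewrite !moment_sigmaf => ->.
by rewrite -addrA; congr ((_ + _) * _); rewrite addrCA; congr (_ + _); field.
Qed.

Lemma Hform_odd_moment n : H 'X^(n.*2.+1) = 0.
Proof. by have [/(_ n)] := hH. Qed.

(** Indexed as in [sym_seq]: [Hgamma n] is [gamma_(n+1)], so even indices carry
    the coefficients that depend on [mu]. *)
Definition Hgamma (n : nat) : C :=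
  q ^+ n./2 * (if odd n then qn n./2.+1 else qn n./2 + mu + 2^-1).

Local Notation B := (sym_seq Hgamma).

(** Induction on [n] by [sym_seq_pairing]. Cancelling common factors, the step
    to [B_(2n+2)] is the identity
    [q^n ([k] + a) - q^n ([n] + a) = q^n ([k] - [n])], and the step to
    [B_(2n+3)] is [q ([k] - [n]) = [k+1] - [n+1]]. *)
Lemma Hform_pairing n k :
  [/\ H (B n.*2 * 'X^(k.*2)) = qfall q k n * m k,
      H (B n.*2 * 'X^(k.*2.+1)) = 0,
      H (B n.*2.+1 * 'X^(k.*2)) = 0 &
      H (B n.*2.+1 * 'X^(k.*2.+1)) = q ^+ n * qfall q k n * m k.+1].
Proof.
elim: n k => [|n IH] k.
  rewrite /qfall !big_ord0 expr0 !mul1r -!exprS.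
  by rewrite -doubleS !Hform_odd_moment.
have [E1 E2 E3 E4] := IH k; have [F1 F2 F3 F4] := IH k.+1.
rewrite doubleS.
have G1 : H (B n.*2.+2 * 'X^(k.*2)) = qfall q k n.+1 * m k.
  rewrite sym_seq_pairing E1 E4 /Hgamma odd_double doubleK qfallSr.
  rewrite Hform_even_momentS /qint; field.
  by rewrite subr_eq0.
(* The step to [B_(2n+3)] evaluates [B_(2n+2)] at the next exponent. *)
have G1' : H (B n.*2.+2 * 'X^(k.*2.+2)) = qfall q k.+1 n.+1 * m k.+1.
  rewrite -doubleS sym_seq_pairing F1 F4 /Hgamma odd_double doubleK qfallSr.
  rewrite Hform_even_momentS /qint; field.
  by rewrite subr_eq0.
have G2 : H (B n.*2.+2 * 'X^(k.*2.+1)) = 0.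
  by rewrite sym_seq_pairing -doubleS E2 F3 mulr0 subrr.
split=> //; rewrite sym_seq_pairing.
  by rewrite G2 E3 mulr0 subrr.
rewrite G1' E4 /Hgamma /= odd_double uphalf_double qfallSS // qfallSr.
rewrite /= exprS /qint !exprS; field.
by rewrite subr_eq0.
Qed.

Lemma Hform_orth n k : (k < n)%N -> H (B n * 'X^k) = 0.
Proof.
rewrite -(odd_double_half n) -(odd_double_half k).
have [E1 E2 E3 E4] := Hform_pairing n./2 k./2.
case: (odd n); case: (odd k); rewrite ?add1n ?add0n ?ltnS ?E1 ?E2 ?E3 ?E4 //.
- by rewrite ltn_double => kn; rewrite qfall_small // mulr0 mul0r.
- by rewrite ltn_double => kn; rewrite qfall_small // mul0r.
Qed.

Lemma excluded_muE n : (mu != - qn n - 2^-1) = (qn n + a != 0).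
Proof. by rewrite -subr_eq0; congr (_ != 0); ring. Qed.

(** Both conditions say that no factor [[n] + a] of the even moments vanishes. *)
Lemma Hform_even_moment_neq0 :
  (forall n, m n != 0) <-> (forall n, mu != - qn n - 2^-1).
Proof.
split=> h n; first by rewrite excluded_muE; apply: contraNneq (h n.+1) => E0;
  rewrite Hform_even_momentS E0 mul0r.
elim: n => [|n IH]; first by rewrite Hform_even_moment0 oner_neq0.
by rewrite Hform_even_momentS mulf_neq0 // -excluded_muE.
Qed.

Lemma Hform_norm_neq0 :
  (forall n, H (B n * 'X^n) != 0) <-> (forall n, mu != - qn n - 2^-1).
Proof.
rewrite -Hform_even_moment_neq0; split=> h n.
  have [E1 _ _ _] := Hform_pairing n n; have := h n.*2.
  by rewrite E1 mulf_eq0 => /norP[].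
have q0 : q != 0 by case: hq.
have [E1 _ _ E4] := Hform_pairing n./2 n./2; rewrite -(odd_double_half n).
by case: (odd n); rewrite ?add1n ?add0n ?E1 ?E4 !mulf_neq0 ?expf_neq0
  ?qfall_neq0.
Qed.

Lemma Hform_MOPS : (forall n, mu != - qn n - 2^-1) -> is_MOPS H B.
Proof.
move=> hmu; apply: MOPS_of_orth; first exact: sym_seq_monic.
  exact: Hform_orth.
exact/Hform_norm_neq0.
Qed.

Lemma Hform_MOPS_unique D n : is_MOPS H D -> D n = B n.
Proof.
move=> HD; have [B1 Bn] := sym_seq_monic Hgamma n.
by rewrite -(MOPS_unique HD B1 Bn) // => k; apply: Hform_orth.
Qed.

(** If [H] is regular, its orthogonal sequence is [B], whose norms are therefore
    nonzero. *)
Lemma Hform_regular : regular H <-> forall n, mu != - qn n - 2^-1.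
Proof.
split=> [[D HD]|/Hform_MOPS HB]; last by exists B.
apply/Hform_norm_neq0 => n; rewrite -(Hform_MOPS_unique n HD) -MOPS_pairing //.
by have [_ [k knz ->]] := HD; rewrite eqxx.
Qed.

Lemma Hform_recurrence_coefs :
  regular H -> recurrence_coefs H (fun=> 0) (fun n => Hgamma n.-1).
Proof.
by move=> /Hform_regular/Hform_MOPS HB; exists B => //; apply: sym_seq_three_term.
Qed.

Lemma Hform_gamma beta gamma n :
  recurrence_coefs H beta gamma -> gamma n.+1 = Hgamma n.
Proof.
case=> D HD; have -> : D = B by apply/funext => k; exact: Hform_MOPS_unique.
exact: sym_seq_coefs.
Qed.

Lemma HgammaE n :
  Hgamma n.*2 = q ^+ n * (qn n + mu + 2^-1) /\
  Hgamma n.*2.+1 = q ^+ n * qn n.+1.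
Proof. by rewrite /Hgamma /= odd_double doubleK uphalf_double. Qed.

(** For the direct implication, [gamma_1 = a > 0] gives [mu > -1/2], so
    [1 + a > 0], and then [gamma_3 = q (1 + a) > 0] gives [q > 0]. The converse
    holds because [q > 0] makes every [[n]] nonnegative. *)
Lemma Hform_positive_definite :
  positive_definite H <-> 0 < q /\ - 2^-1 < mu.
Proof.
split=> [[_ _ [beta [gamma [Hc gpos]]]]|[q0 mu0]].
  have g n : 0 < Hgamma n by rewrite -(Hform_gamma n Hc).
  have mu0 : 0 < mu + 2^-1.
    by have [E _] := HgammaE 0; have := g 0%N; rewrite E mul1r qint0 add0r.
  split; last by rewrite -subr_gt0 opprK.
  have [E _] := HgammaE 1; have := g 2%N; rewrite E expr1 pmulr_lgt0 //.
  by rewrite /qint expr1 divff ?subr_eq0 // -addrA addr_gt0.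
have mu1 : 0 < mu + 2^-1 by rewrite -[2^-1]opprK subr_gt0.
have qn0 n : 0 <= qn n.
  by case: n => [|n]; rewrite ?qint0 // ltW ?qint_gt0.
have Hreg : regular H.
  apply/Hform_regular => n.
  by rewrite excluded_muE gt_eqF // ltr_wpDl.
split=> //; first by case: hH.
exists (fun=> 0), (fun n => Hgamma n.-1).
split=> [|n /=]; first exact: Hform_recurrence_coefs.
rewrite /Hgamma mulr_gt0 ?exprn_gt0 //; case: ifP => _; first exact: qint_gt0.
by rewrite -addrA ltr_wpDl.
Qed.

Variable r : C.
Hypothesis rq : r ^+ 2 = q.

Lemma root_neq1 : r != 1.
Proof. by apply: contraNneq q1 => r1; rewrite -rq r1 expr1n. Qed.

Lemma root_addr1_neq0 : r + 1 != 0.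
Proof.
apply: contraNneq q1 => /eqP; rewrite addr_eq0 -rq => /eqP ->.
by rewrite sqrrN expr1n.
Qed.

Local Notation Psi := ((r + 1) *: ('X^2 - (mu + 2^-1)%:P)).

(** On [x^n] the equation reads
    [(r + 1) (u_(n+2) - a u_n) = (qint r n) u_n] for the moments [u] of [H]. It
    is trivial for odd [n]; for [n = 2k] the right-hand side is
    [(r + 1) [k] u_n], and this is the recurrence of the even moments. *)
Lemma Hform_Pearson : Pearson r H 'X Psi.
Proof.
have E n : Hf r (Defs.mulf 'X H) 'X^n + Defs.mulf Psi H 'X^n = 0.
  rewrite /Hf /= /Defs.mulf mulX_Hop_Xn ?root_neq1 //.
  rewrite -scalerAl mulrBl mul_polyC -exprD.
  rewrite !(formZ H) (formB H) (formZ H) -(odd_double_half n) add2n.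
  case: (odd n); rewrite ?add1n ?add0n -?doubleS.
    by rewrite !Hform_odd_moment !mulr0 subrr mulr0 oppr0 addr0.
  have mE k : H 'X^(k.*2) = m k by [].
  by rewrite !mE Hform_even_momentS qint_sqr ?rq //; ring.
move=> f; rewrite -[f]coefK poly_def !linear_sum -big_split /= big1 // => i _.
by rewrite !linearZ /= -mulrDr E mulr0.
Qed.

(** At the only zero 0 of [Phi], [r Psi(0) + (Hop r Phi)(0)] equals
    [1 - r (r + 1) a], so already the first summand is positive. *)
Lemma Hform_class_condition :
  mu != (r * (r + 1))^-1 - 2^-1 -> class_condition r H 'X Psi.
Proof.
move=> hmu; rewrite /class_condition.
have -> : [set c : C | root 'X c]%classic = [set 0]%classic.
  by apply/seteqP; split=> c /=; rewrite /root hornerX => /eqP.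
rewrite fsbig_set1 ltr_pwDl ?normr_ge0 // normr_gt0.
have -> : Hop r 'X = 1 :> {poly C}.
  apply: (@mulfI _ 'X); first by rewrite polyX_eq0.
  rewrite -[X in Hop r X]expr1 mulX_Hop_Xn ?root_neq1 //.
  rewrite /qint expr1 divff ?scale1r ?mulr1 //.
  by rewrite subr_eq0 root_neq1.
have r0 : r != 0 by apply: contraNneq (proj1 hq) => r0; rewrite -rq r0 expr0n.
have rp := root_addr1_neq0.
apply: contraNneq hmu; rewrite mulr0 !hornerE /= => E.
apply/eqP/(mulfI (mulf_neq0 r0 rp)); rewrite mulrBr divff ?mulf_neq0 //.
by apply/eqP; rewrite -subr_eq0 -oppr_eq0 -{}E; apply/eqP; ring.
Qed.

Lemma Hform_semiclassical : mu != (r * (r + 1))^-1 - 2^-1 ->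
  (forall n, mu != - qn n - 2^-1) -> semiclassical_of_class r H 1.
Proof.
move=> hr hmu; exists 'X, Psi.
have sPsi : size Psi = 3.
  by rewrite size_scale ?root_addr1_neq0 // size_XnsubC.
split; last by rewrite sPsi size_polyX.
  split; rewrite ?monicX ?sPsi //; first exact/Hform_regular.
  exact: Hform_Pearson.
exact: Hform_class_condition.
Qed.

End HForm.

Theorem proposition2 (R : realType) (q mu : R[i]) (H : cform R)
    (hq : Ctilde q) (hH : is_Hform mu q H) :
  [/\ (regular H ->
        (exists beta gamma, recurrence_coefs H beta gamma) /\
        forall beta gamma, recurrence_coefs H beta gamma ->
          forall n : nat,
            gamma n.*2.+1 = q ^+ n * (qint q n + mu + 2^-1) /\
            gamma n.*2.+2 = q ^+ n * qint q n.+1),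
      (regular H <-> forall n : nat, mu != - qint q n - 2^-1),
      (positive_definite H <-> 0 < q /\ - 2^-1 < mu) &
      let r := sqrtc q in
      mu != (r * (r + 1))^-1 - 2^-1 ->
      (forall n : nat, mu != - qint q n - 2^-1) ->
      let Psi := (r + 1) *: ('X^2 - (mu + 2^-1)%:P) in
      [/\ semiclassical_of_class r H 1,
          Pearson r H 'X Psi &
          class_condition r H 'X Psi]].
Proof.
have rq : sqrtc q ^+ 2 = q by exact: sqr_sqrtc.
split.
- move=> Hreg; split.
    by eexists; eexists; exact: (Hform_recurrence_coefs hq hH Hreg).
  move=> beta gamma Hc n; rewrite !(Hform_gamma hq hH _ Hc).
  exact: HgammaE.
- exact: Hform_regular.
- exact: Hform_positive_definite.
- move=> r hr hmu Psi; split.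
  + exact: (Hform_semiclassical hq hH rq).
  + exact: (Hform_Pearson hq hH rq).
  + exact: (Hform_class_condition H hq rq hr).
Qed.
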